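(* For a positive integer $k$, let $p_k(n)$ denote the number of $k$-colored partitions of $n$, with generating function $$P_k(x)=\sum_{n\ge0}p_k(n)x^n=\prod_{m\ge1}(1-x^m)^{-k}.$$ If $p$ is a prime, then $p_p(n)\equiv0\pmod p$ whenever $p\nmid n$.
   Context: A $k$-colored partition of $n$ is a partition of $n$ in which each part is assigned one of $k$ colors (order of parts being irrelevant). Here $p_p(n)$ means $p_k(n)$ with $k=p$. Series and products are formal power series. *)

(* Defs.v *)
From mathcomp Require Import all_boot.

Set Implicit Arguments.
Unset Strict Implicit.
Unset Printing Implicit Defensive.

(* A k-colored partition of n is a multiset of pairs (part, color) with positive
   parts summing to n, given by its multiplicity function: f (i, c) is the
   number of parts equal to i.+1 with color c (hence the shift by one).
   Restricting parts and multiplicities to be at most n loses nothing, since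
   the parts are positive and sum to n. *)
Definition colored_partitions (k n : nat) : {set {ffun 'I_n * 'I_k -> 'I_n.+1}} :=
  [set f : {ffun 'I_n * 'I_k -> 'I_n.+1} |
     \sum_(ic : 'I_n * 'I_k) f ic * ic.1.+1 == n].

Definition num_colored_partitions (k n : nat) : nat :=
  #|colored_partitions k n|.

(* Main.v *)
(** The cyclic group of order [p] acts on the colored partitions of [n] by
    rotating the colors, so their number is congruent modulo [p] to the number of
    fixed points.  In a fixed point every part occurs equally often in each of the
    [p] colors, which makes [n] a multiple of [p]. *)
Require Import Defs.
From mathcomp Require Import all_boot.
From mathcomp Require Import fingroup action pgroup sylow zmodp.

Set Implicit Arguments.
Unset Strict Implicit.
Unset Printing Implicit Defensive.

Section ColorRotation.

Variables (T V : finType) (k : nat).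
Implicit Type f : {ffun T * 'I_k.+1 -> V}.

(** With [k.+1] colors, ['I_k.+1] is the additive group modulo [k.+1], serving both as color set and
    as acting group. *)
Definition rotate_colors f (j : 'I_k.+1) : {ffun T * 'I_k.+1 -> V} :=
  [ffun ic => f (ic.1, Zp_add ic.2 j)].

Lemma rotate_colors1 : rotate_colors^~ 1%g =1 id.
Proof. by move=> f; apply/ffunP=> -[i c]; rewrite ffunE /= Zp_addC Zp_add0z. Qed.

Lemma rotate_colorsM f : act_morph rotate_colors f.
Proof.
move=> a b; apply/ffunP=> -[i c].
by rewrite !ffunE /= -Zp_addA [Zp_add b a]Zp_addC.
Qed.

Definition color_action := TotalAction rotate_colors1 rotate_colorsM.

(** Invariance under the rotation by [c] itself, read at color zero. *)
Lemma color_action_fixE f i c :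
  f \in 'Fix_color_action([set: 'I_k.+1])%g -> f (i, c) = f (i, Zp0).
Proof.
move=> /afixP/(_ c (in_setT c)) /ffunP/(_ (i, Zp0)).
by rewrite ffunE /= Zp_add0z.
Qed.

End ColorRotation.

(** A rotation permutes the pairs of part and color and keeps the part, so it only reindexes the
    weighted sum. *)
Lemma color_action_acts k n :
  [acts [set: 'I_k.+1], on colored_partitions k.+1 n | color_action _ _ k]%g.
Proof.
apply/subsetP=> j _; apply/astabsP=> f; rewrite !inE.
pose h (ic : 'I_n * 'I_k.+1) := (ic.1, Zp_add ic.2 j).
have h_inj : injective h.
  apply: (can_inj (g := fun ic => (ic.1, Zp_add ic.2 (Zp_opp j)))) => -[i c].
  by rewrite /h /= -Zp_addA [Zp_add j _]Zp_addC Zp_addNz Zp_addC Zp_add0z.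
rewrite [in RHS](reindex_inj h_inj) /=.
by under eq_bigr do rewrite ffunE.
Qed.

Lemma color_action_no_fix k n : ~~ (k.+1 %| n) ->
  'Fix_(colored_partitions k.+1 n | color_action _ _ k)([set: 'I_k.+1])%g = set0.
Proof.
move=> k_ndvd_n; apply/setP=> f; rewrite in_set0.
apply/negP=> /setIP[]; rewrite inE => /eqP sum_f fix_f; case/negP: k_ndvd_n.
rewrite -sum_f (eq_bigr (fun ic => f (ic.1, ic.2) * ic.1.+1)) => [|[] //].
rewrite -(pair_bigA _ (fun i c => f (i, c) * i.+1)) /=.
apply: dvdn_sum => i _.
(* For a fixed part size the summand no longer depends on the color: the sum is [k.+1] equal
   terms. *)
under eq_bigr do rewrite (color_action_fixE _ _ fix_f).
by rewrite sum_nat_const card_ord dvdn_mulr.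
Qed.

Theorem corollary2p6 (p n : nat) (p_prime : prime p) (p_ndvd_n : ~~ (p %| n)) :
  num_colored_partitions p n = 0 %[mod p].
Proof.
(* A prime is nonzero, so it has the form [k.+1] that the color group requires. *)
case: p p_prime p_ndvd_n => // k p_prime p_ndvd_n.
have pG : ((k.+1).-group [set: 'I_k.+1])%g.
  by rewrite /pgroup cardsT card_ord pnat_id.
rewrite /num_colored_partitions.
by rewrite (pgroup_fix_mod pG (color_action_acts k n)) color_action_no_fix ?cards0.
Qed.
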